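(* Let $q\ge 2$ and $n\ge 1$ be integers and let $S=(s_i)$ be an orientable sequence of order $n$ over $\mathbb{Z}_q$ with period $m$ and ring sequence $[s_0,\dots,s_{m-1}]$. Then: (i) if $m$ is odd and $q$ is odd, $A^{-1}(S)$ consists of one orientable sequence of order $n+1$ and period $m$, together with two shifts of each of $\frac{q-1}{2}$ orientable sequences of order $n+1$ and period $2m$ which are alternating sign translates of one another; (ii) if $m$ is odd, $q$ is even and $2x=w^A_q(S)$ for some $x\in\mathbb{Z}_q$, $A^{-1}(S)$ consists of two orientable sequences of order $n+1$ and period $m$ which are alternating sign translates of each other, together with two shifts of each of $\frac{q-2}{2}$ orientable sequences of order $n+1$ and period $2m$ which are alternating sign translates of each other; (iii) if $m$ is odd, $q$ is even and there is no $x\in\mathbb{Z}_q$ with $2x=w^A_q(S)$, $A^{-1}(S)$ consists of two shifts of each of $\frac{q}{2}$ orientable sequences of order $n+1$ and period $2m$ which are alternating sign translates of each other; (iv) if $m$ is even and $w^A_q(S)$ has additive order $h$ in $\mathbb{Z}_q$, $A^{-1}(S)$ consists of $h$ shifts of each of $\frac{q}{h}$ mutually o-disjoint orientable sequences of order $n+1$ and period $hm$ which are alternating sign translates of one another.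
   Context: Sequences are periodic over $\mathbb{Z}_q$; period means least period. For $S=(s_i)$ of period $m$, $\mathbf{s}_n(i)=(s_i,\dots,s_{i+n-1})$. For $\mathbf{u}=(u_0,\dots,u_{n-1})$, $\mathbf{u}^R=(u_{n-1},\dots,u_0)$. $S$ is an orientable sequence of order $n$ if $\mathbf{s}_n(i)=\mathbf{s}_n(j)$ implies $i\equiv j\pmod m$ and $\mathbf{s}_n(i)\neq\mathbf{s}_n(j)^R$ for all $i,j$. Two such sequences $S,S'$ are o-disjoint if $\mathbf{s}_n(i)\neq\mathbf{s}'_n(j)$ and $\mathbf{s}_n(i)\neq\mathbf{s}'_n(j)^R$ for all $i,j$. The alternating sign weight is $w^A_q(S)=\sum_{i=0}^{m-1}(-1)^{m-1-i}s_i \bmod q$, computed from the ring sequence $[s_0,\dots,s_{m-1}]$. $A$ maps a periodic sequence $(t_i)$ to $(t_i+t_{i+1})$, and $A^{-1}(S)$ is the set of all periodic sequences $T$ with $A(T)=S$. A shift of $(t_i)$ is $(t_{i+k})$; an alternating sign translate of $(t_i)$ is a sequence $(t_i+(-1)^i c)$ for some nonzero $c\in\mathbb{Z}_q$. *)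

(* Defs.v *)
From HB Require Import structures.
From mathcomp Require Import all_boot all_order all_algebra all_fingroup.

Set Implicit Arguments.
Unset Strict Implicit.
Unset Printing Implicit Defensive.

Import GRing.Theory.
Local Open Scope ring_scope.

(* 'Z_q is the ring of integers mod q only for 1 < q. Sequences are compared   *)
(* pointwise, by =1.                                                           *)
Definition zseq (q : nat) := nat -> 'Z_q.

Definition has_cycle q (S : zseq q) (m : nat) : Prop :=
  (0 < m)%N /\ forall i, S (i + m)%N = S i.

Definition periodic q (S : zseq q) : Prop := exists m, has_cycle S m.

Definition least_period q (S : zseq q) (m : nat) : Prop :=
  has_cycle S m /\ forall p, has_cycle S p -> (m <= p)%N.

Definition window q (n : nat) (S : zseq q) (i : nat) : seq 'Z_q :=
  mkseq (fun k => S (i + k)%N) n.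

(* m is the least period, and is therefore determined by S. *)
Definition orientable q (n m : nat) (S : zseq q) : Prop :=
  [/\ least_period S m,
      forall i j, window n S i = window n S j -> i = j %[mod m]
    & forall i j, window n S i <> rev (window n S j)].

Definition o_disjoint q (n : nat) (S S' : zseq q) : Prop :=
  forall i j, window n S i <> window n S' j
           /\ window n S i <> rev (window n S' j).

Definition alt_weight q (m : nat) (S : zseq q) : 'Z_q :=
  \sum_(i < m) (-1) ^+ (m - 1 - i) * S i.

Definition sum_map q (T : zseq q) : zseq q := fun i => T i + T i.+1.

Definition sum_preimage q (S T : zseq q) : Prop :=
  periodic T /\ sum_map T =1 S.

Definition shift q (k : nat) (T : zseq q) : zseq q := fun i => T (i + k)%N.

Definition alt_translate q (T T' : zseq q) : Prop :=
  exists2 c : 'Z_q, c != 0 & T' =1 (fun i => T i + (-1) ^+ i * c).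

Definition mutual_alt_translates q (r : nat) (U : 'I_r -> zseq q) : Prop :=
  forall k l, k != l -> alt_translate (U k) (U l).

(* The family F lists the members of P without repetition. *)
Definition consists_of q (P : zseq q -> Prop) (I : Type) (F : I -> zseq q) :
    Prop :=
  [/\ forall x, P (F x),
      forall x y, F x =1 F y -> x = y
    & forall T, P T -> exists x, T =1 F x].

(* h shifts of each U k, the j-th being by a k j; that these are distinct is   *)
(* imposed by consists_of.                                                     *)
Definition shifts_of q (r h : nat) (U : 'I_r -> zseq q)
    (a : 'I_r -> 'I_h -> nat) (x : 'I_r * 'I_h) : zseq q :=
  shift (a x.1 x.2) (U x.1).

Definition join_families q (I J : Type) (F : I -> zseq q) (G : J -> zseq q)
    (x : I + J) : zseq q :=
  match x with inl i => F i | inr j => G j end.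

(* Main.v *)
(* A preimage of [S] is determined by its initial term [c]: it is [antisum S c],
   and shifting it by [m] gives the preimage with initial term
   [step c = (-1)^m c + w], where [w] is the alternating weight of [S].  An
   [(n+1)]-window of a preimage determines an [n]-window of [S], so every
   preimage is orientable and its least period is [m] times the length of the
   [step]-orbit of its initial term; the theorem is thus the orbit structure of
   [step] on [Z_q]: the involution [c |-> w - c] if [m] is odd, the translation
   by [w] if [m] is even. *)
Require Import Defs.
From HB Require Import structures.
From mathcomp Require Import all_boot all_order all_algebra all_fingroup.
From mathcomp Require Import cyclic zify.

Set Implicit Arguments.
Unset Strict Implicit.
Unset Printing Implicit Defensive.

Import GRing.Theory.
Local Open Scope ring_scope.

(** * Preimages under [sum_map], parametrised by the initial term *)

Fixpoint antisum q (S : zseq q) (c : 'Z_q) (i : nat) : 'Z_q :=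
  if i is j.+1 then S j - antisum S c j else c.

Section Antisum.

Variables (q : nat) (S : zseq q).
Implicit Types (T : zseq q) (c d : 'Z_q).

Lemma sum_map_antisum c : sum_map (antisum S c) =1 S.
Proof. by move=> i; rewrite /sum_map /= addrC subrK. Qed.

Lemma antisum_unique T : sum_map T =1 S -> T =1 antisum S (T 0%N).
Proof.
by move=> TS; elim=> //= i <-; rewrite -TS /sum_map addrC addKr.
Qed.

(** Consecutive sums of two preimages agree, so their difference changes sign at every step. *)
Lemma antisum_translate c d i :
  antisum S d i = antisum S c i + (-1) ^+ i * (d - c).
Proof.
elim: i => [|i IHi] /=; first by rewrite expr0 mul1r addrC subrK.
by rewrite IHi exprS mulN1r mulNr opprD addrA.
Qed.

(** The sign [(-1) ^+ i] is cancelled as a regular element, since ['Z_q] may have zero divisors. *)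
Lemma antisum_inj c d i : antisum S c i = antisum S d i -> c = d.
Proof.
move=> /eqP; rewrite (antisum_translate c d) -subr_eq0 opprD addNKr.
rewrite oppr_eq0 mulrI_eq0 ?subr_eq0 => [/eqP //|].
exact: lregX (@lregN _ _ (@lreg1 _)).
Qed.

(** The recurrence unrolled [p] times; at [p = m] it is the formula for [step]. *)
Lemma antisum_alt_weight c p :
  antisum S c p = (-1) ^+ p * c + alt_weight p S.
Proof.
elim: p => [|p IHp] /=; first by rewrite /alt_weight big_ord0 expr0 mul1r addr0.
rewrite IHp /alt_weight big_ord_recr /= subSS subn0 subnn expr0 mul1r.
rewrite exprS mulN1r mulNr opprD [LHS]addrC -addrA.
congr (_ + (_ + _)); rewrite -sumrN; apply: eq_bigr => i _.
by rewrite -mulNr -[- _]mulN1r -exprS -subnDA add1n subnSK // subSS subn0.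
Qed.

Lemma mutual_alt_translates_antisum r (u : 'I_r -> 'Z_q) :
  injective u -> mutual_alt_translates (fun k => antisum S (u k)).
Proof.
move=> u_inj k l nkl; exists (u l - u k); last exact: antisum_translate.
by rewrite subr_eq0 eq_sym (inj_eq u_inj).
Qed.

End Antisum.

(** * Windows, their reversals and the passage to sums *)

Lemma eq_window q n (T T' : zseq q) i j :
  window n T i = window n T' j <->
  forall k, (k < n)%N -> T (i + k)%N = T' (j + k)%N.
Proof.
split=> [E k ltkn | E].
  by have /(congr1 (nth 0 ^~ k)) := E; rewrite /= !nth_mkseq.
apply: (@eq_from_nth _ 0); rewrite !size_mkseq // => k ltkn.
by rewrite !nth_mkseq // E.
Qed.

Lemma eq_window_rev q n (T T' : zseq q) i j :
  window n T i = rev (window n T' j) <->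
  forall k, (k < n)%N -> T (i + k)%N = T' (j + (n - k.+1))%N.
Proof.
have sz := size_mkseq.
split=> [E k ltkn | E].
  have /(congr1 (nth 0 ^~ k)) := E; rewrite /= nth_rev ?sz //.
  by rewrite !nth_mkseq //; lia.
apply: (@eq_from_nth _ 0); rewrite ?size_rev !sz // => k ltkn.
by rewrite nth_rev ?sz // !nth_mkseq ?E //; lia.
Qed.

Lemma window_sum_map q n (T T' : zseq q) i j :
  window n.+1 T i = window n.+1 T' j ->
  window n (sum_map T) i = window n (sum_map T') j.
Proof.
move=> /eq_window E; apply/eq_window => k ltkn.
by rewrite /sum_map -!addnS !E // ltnS ltnW.
Qed.

(** Reversal is preserved because the sum of two neighbours does not depend on their order. *)
Lemma window_rev_sum_map q n (T T' : zseq q) i j :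
  window n.+1 T i = rev (window n.+1 T' j) ->
  window n (sum_map T) i = rev (window n (sum_map T') j).
Proof.
move=> /eq_window_rev E; apply/eq_window_rev => k ltkn.
rewrite /sum_map -!addnS !E ?ltnS //; last exact: ltnW.
by rewrite addrC !subSS subnSK.
Qed.

Lemma eq_window_seq q n (S S' : zseq q) i :
  S =1 S' -> window n S i = window n S' i.
Proof. by move=> E; apply: eq_mkseq => k; exact: E. Qed.

(** * Periods and orientability of the preimages of an orientable sequence *)

Section Preimages.

Variables (q n m : nat) (S : zseq q).
Hypothesis hS : orientable n m S.

Let step c := antisum S c m.

(** From position [m] on, the recurrence reads the same terms of [S] again, now starting from
    [step c]. *)
Lemma antisum_add_period c i j :
  antisum S c (i + j * m)%N = antisum S (iter j step c) i.
Proof.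
have [[[_ Sm] _] _ _] := hS.
have shift1 d k : antisum S d (k + m)%N = antisum S (step d) k.
  by elim: k => //= k <-; rewrite Sm.
elim: j c => [|j IHj] c; first by rewrite addn0.
by rewrite mulSn addnCA addnC shift1 IHj -iterSr.
Qed.

Lemma shift_antisum c j :
  shift (j * m) (antisum S c) =1 antisum S (iter j step c).
Proof. by move=> i; exact: antisum_add_period. Qed.

Lemma has_cycle_antisum c j :
  (0 < j)%N -> iter j step c = c -> has_cycle (antisum S c) (j * m).
Proof.
have [[[m_gt0 _] _] _ _] := hS => j_gt0 E.
by split=> [|i]; rewrite ?muln_gt0 ?j_gt0 // antisum_add_period E.
Qed.

(** A period of the preimage is one of [S], and uniqueness of windows in [S] makes it a multiple of
    [m]. *)
Lemma antisum_cycle c p : has_cycle (antisum S c) p ->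
  exists2 j, p = (j * m)%N & (0 < j)%N /\ iter j step c = c.
Proof.
have [[[m_gt0 _] _] Sinj _] := hS => -[p_gt0 E].
have Sp i : S (i + p)%N = S i.
  by rewrite -!(sum_map_antisum S c) /sum_map -addSn !E.
have /dvdnP[j Ej] : (m %| p)%N.
  have /Sinj : window n S p = window n S 0.
    by apply/eq_window => k _; rewrite addnC add0n.
  by rewrite mod0n => /eqP.
exists j => //; split; first by case: j Ej p_gt0 => // ->.
by apply: (@antisum_inj _ S _ _ 0); rewrite -antisum_add_period -Ej E.
Qed.

(** Uniqueness of windows in [S] gives [i = j] modulo [m]. Moving by whole periods brings both
    preimages to position [i], where a single term determines the initial term. *)
Lemma window_antisum c d i j :
  window n.+1 (antisum S c) i = window n.+1 (antisum S d) j -> (i <= j)%N ->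
  exists2 k, j = (i + k * m)%N & c = iter k step d.
Proof.
have [_ Sinj _] := hS => E leij.
have /Sinj Eij: window n S i = window n S j.
  rewrite -(eq_window_seq n _ (sum_map_antisum S c)) (window_sum_map E).
  exact/eq_window_seq/sum_map_antisum.
have /dvdnP[k Ek] : (m %| j - i)%N by rewrite -eqn_mod_dvd // Eij.
have jE : j = (i + k * m)%N by rewrite -Ek subnKC.
exists k => //; apply: (@antisum_inj _ S _ _ i).
by move/eq_window/(_ 0%N isT): E; rewrite !addn0 [in RHS]jE antisum_add_period.
Qed.

Lemma window_antisum_rev c d i j :
  window n.+1 (antisum S c) i <> rev (window n.+1 (antisum S d) j).
Proof.
have [_ _ Srev] := hS => /window_rev_sum_map.
by rewrite !(eq_window_seq n _ (sum_map_antisum S _)) => /Srev.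
Qed.

(** Here [p] is the length of the [step]-orbit of [c]. Equal windows at distance [k * m] make [k] a
    return time of [c], hence a multiple of [p]. *)
Lemma orientable_antisum c p : (0 < p)%N -> iter p step c = c ->
    (forall j, (0 < j)%N -> iter j step c = c -> (p %| j)%N) ->
  orientable n.+1 (p * m) (antisum S c).
Proof.
move=> p_gt0 Ep pmin; split; last exact: window_antisum_rev.
  split; first exact: has_cycle_antisum.
  move=> _ /antisum_cycle[j -> [j_gt0 /pmin pj]].
  by rewrite leq_mul // dvdn_leq // pj.
move=> i j; wlog leij : i j / (i <= j)%N => [WH E | E].
  by case/orP: (leq_total i j) => [/WH|/WH/(_ (esym E))/esym]; first exact.
have [k -> /esym Ek] := window_antisum E leij.
have /dvdnP[t ->] : (p %| k)%N.
  by case: k Ek => [|k] Ek; rewrite ?dvdn0 ?pmin.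
by rewrite -mulnA addnC modnMDl.
Qed.

(** Two assumptions appear because the earlier of two equal windows may lie in either sequence. *)
Lemma o_disjoint_antisum c d : (forall k, iter k step c <> d) ->
    (forall k, iter k step d <> c) ->
  o_disjoint n.+1 (antisum S c) (antisum S d).
Proof.
move=> ncd ndc i j; split; last exact: window_antisum_rev.
case/orP: (leq_total i j) => [leij E | leji /esym E].
  by have [k _ /esym/ndc] := window_antisum E leij.
by have [k _ /esym/ncd] := window_antisum E leji.
Qed.

Lemma step_inj : injective step.
Proof. by move=> c d; exact: antisum_inj. Qed.

(** Periodicity holds because [step] is an injective map of a finite set, so [c] lies on a cycle. *)
Lemma sum_preimage_antisum c : sum_preimage S (antisum S c).
Proof.
split; last exact: sum_map_antisum.
exists (fingraph.order step c * m)%N; apply: has_cycle_antisum.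
  exact: fingraph.order_gt0.
exact: iter_order step_inj c.
Qed.

(** By counting, an injective [e] already reaches every initial term, so no preimage is missed. *)
Lemma consists_of_antisum (I : finType) (e : I -> 'Z_q) (F : I -> zseq q) :
    (1 < q)%N -> injective e -> #|I| = q ->
    (forall x, F x =1 antisum S (e x)) ->
  consists_of (sum_preimage S) F.
Proof.
move=> q_gt1 e_inj cardI FE; split=> [x | x y Exy | T [_ /antisum_unique TE]].
- have [[p [p_gt0 Ep]] ES] := sum_preimage_antisum (e x).
  split; first by exists p; split=> // i; rewrite !FE.
  by move=> i; rewrite -ES /sum_map !FE.
- by apply: e_inj; have := Exy 0%N; rewrite !FE.
have [|e' _ eK] := inj_card_bij e_inj; first by rewrite cardI card_ord Zp_cast.
by exists (e' (T 0%N)) => i; rewrite FE eK.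
Qed.

End Preimages.

(** * Residues modulo [q], additive orders and cosets *)

Lemma natr_Zp_inj q a b : (1 < q)%N -> (a < q)%N -> (b < q)%N ->
  a%:R = b%:R :> 'Z_q -> a = b.
Proof.
move=> q_gt1 ltaq ltbq /(congr1 val).
by rewrite /= !val_Zp_nat // !modn_small.
Qed.

Lemma order_Zp_dvd q (w : 'Z_q) j : (#[w]%g %| j)%N = (w *+ j == 0).
Proof. by rewrite order_dvdn FinRing.zmodXgE. Qed.

Lemma order_Zp_dvd_modulus q (w : 'Z_q) : (1 < q)%N -> (#[w]%g %| q)%N.
Proof. by move=> q_gt1; rewrite order_Zp_dvd -mulr_natr pchar_Zp // mulr0. Qed.

Section CyclicCosets.

Variables (q : nat) (w : 'Z_q).
Hypothesis q_gt1 : (1 < q)%N.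

Let h := #[w]%g.

(* The residues below [q / h] are representatives of the cosets of [<w>]. *)
Lemma natr_coset_inj (k l : 'I_(q %/ h)) i j :
  k%:R + w *+ i = l%:R + w *+ j -> k = l /\ w *+ i = w *+ j.
Proof.
have h_gt0 : (0 < h)%N := order_gt0 w.
have hq : (q %/ h * h = q)%N by rewrite divnK // order_Zp_dvd_modulus.
have lt_hq (k' : 'I_(q %/ h)) : (k' * h < q)%N.
  by rewrite -[X in (_ < X)%N]hq ltn_pmul2r.
have w_h t : w *+ t *+ h = 0.
  by apply/eqP; rewrite -mulrnA -order_Zp_dvd dvdn_mull.
(* Multiplying by [h] kills the multiples of [w]; since [k * h] and [l * h] are below [q], they
   agree as natural numbers. *)
move=> E; have /natr_Zp_inj Ekl : (k * h)%:R = (l * h)%:R :> 'Z_q.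
  have := congr1 (fun z => z *+ h) E.
  by rewrite /= !mulrnDl !w_h !addr0 !mulrnA.
have kl : k = l.
  by apply/val_inj/eqP; rewrite -(eqn_pmul2r h_gt0) Ekl.
by split=> //; move: E; rewrite kl => /addrI.
Qed.

Lemma mulrn_order_inj (i j : 'I_h) : w *+ i = w *+ j -> i = j.
Proof.
move=> E; apply/val_inj/eqP; move/eqP: E.
by rewrite -!FinRing.zmodXgE eq_expg_mod_order /= !modn_small.
Qed.

End CyclicCosets.

(** Offsets from a centre [c0] with [c0 + c0 + s%:R = w]: the involution [c |-> w - c] exchanges the
    offsets [f k] and [s - f k]. *)
Definition pair_offset r (f : 'I_r -> nat) s (x : 'I_r * 'I_2) : nat :=
  if x.2 == 0%N :> nat then f x.1 else (s - f x.1)%N.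

(** The bound puts every [f k] strictly below every mirror value [s - f l], so the two halves cannot
    meet. *)
Lemma pair_offset_inj r (f : 'I_r -> nat) s :
  injective f -> (forall k l, (f k + f l < s)%N) -> injective (pair_offset f s).
Proof.
move=> f_inj lt_s [k i] [l j]; rewrite /pair_offset /=.
have [[lt_kk lt_kl] lt_ll] := (lt_s k k, lt_s k l, lt_s l l).
case: i j => [[|[|//]] lt_i] [[|[|//]] lt_j] /= E; try lia.
all: have /f_inj kl : f k = f l by lia.
all: by congr (_, _); [exact: kl | exact: val_inj].
Qed.

Lemma pair_offset_gt0_lt r (f : 'I_r -> nat) s x :
  (forall k, (0 < f k < s)%N) -> (0 < pair_offset f s x < s)%N.
Proof.
by move/(_ x.1) => lt_f; rewrite /pair_offset; case: ifP => // _; lia.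
Qed.

Lemma pair_offset_le r (f : 'I_r -> nat) s x :
  (forall k, (f k <= s)%N) -> (pair_offset f s x <= s)%N.
Proof.
by move/(_ x.1) => le_f; rewrite /pair_offset; case: ifP => // _; lia.
Qed.

(** * Odd period: orbits of an involution *)

Section OddPeriod.

Variables (q n m : nat) (S : zseq q).
Hypotheses (q_gt1 : (1 < q)%N) (hS : orientable n m S) (odd_m : odd m).

Let w := alt_weight m S.

Lemma antisum_odd_period c : antisum S c m = w - c.
Proof. by rewrite antisum_alt_weight -signr_odd odd_m expr1 mulN1r addrC. Qed.

Lemma orientable_antisum_fixed c : antisum S c m = c ->
  orientable n.+1 m (antisum S c).
Proof.
move=> Ec; rewrite -[X in orientable _ X]mul1n.
by apply: orientable_antisum => // j _ _; exact: dvd1n.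
Qed.

Lemma orientable_antisum_moved c : antisum S c m <> c ->
  orientable n.+1 (2 * m) (antisum S c).
Proof.
have step2 d : antisum S (antisum S d m) m = d.
  by rewrite !antisum_odd_period subKr.
move=> Nc; apply: orientable_antisum => // [|j _].
  by rewrite /= step2.
(* The even part of [j] acts trivially, so a return to the moved point [c] forces [j] to be even. *)
rewrite -(odd_double_half j) iterD -muln2 iterM.
rewrite [iter j./2 _ _]iter_fix /= ?step2 // dvdn2 oddD oddM andbF addbF oddb.
by case: (odd j).
Qed.

(* [a] and [b] are matched by the involution [c |-> w - c] centred at [c0]. *)
Lemma antisum_odd_swap c0 a b : c0 + c0 + (a + b)%:R = w ->
  antisum S (c0 + a%:R) m = c0 + b%:R.
Proof.
move=> Ew; rewrite antisum_odd_period -Ew natrD.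
by apply/eqP; rewrite subr_eq addrACA addrC.
Qed.

(** Initial terms written as [c0] plus a natural number below [q] reduce injectivity in ['Z_q] to
    injectivity in [nat]. *)
Lemma consists_of_antisum_nat (I : finType) (N : I -> nat) c0
    (F : I -> zseq q) :
    injective N -> (forall x, (N x < q)%N) -> #|I| = q ->
    (forall x, F x =1 antisum S (c0 + (N x)%:R)) ->
  consists_of (sum_preimage S) F.
Proof.
move=> N_inj ltNq; apply: (consists_of_antisum hS q_gt1) => x y /addrI.
by move/natr_Zp_inj => E; apply/N_inj/E.
Qed.

Lemma shifts_of_pairs r (f : 'I_r -> nat) s c0 x :
    c0 + c0 + s%:R = w -> (forall k, (f k <= s)%N) ->
  shifts_of (fun k => antisum S (c0 + (f k)%:R))
      (fun _ (j : 'I_2) => (j * m)%N) x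
    =1 antisum S (c0 + (pair_offset f s x)%:R).
Proof.
move=> Ew les i; rewrite /shifts_of (shift_antisum hS) /pair_offset.
case: x.2 => -[|[|//]] //= _.
by rewrite (@antisum_odd_swap _ _ (s - f x.1)) // subnKC.
Qed.

(** The bounds give [a < s - a < q], so the two matched offsets are different residues and the
    initial term is moved. *)
Lemma orientable_pair c0 s a : c0 + c0 + s%:R = w ->
    (a + a < s)%N -> (s - a < q)%N ->
  orientable n.+1 (2 * m) (antisum S (c0 + a%:R)).
Proof.
move=> Ew lt_as lt_sq; apply: orientable_antisum_moved.
rewrite (@antisum_odd_swap _ _ (s - a)) ?subnKC //; last lia.
move/addrI/natr_Zp_inj => E.
have : (s - a = a)%N by apply: E => //; lia.
lia.
Qed.

End OddPeriod.

(** * Even period: orbits of a translation *)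

Section EvenPeriod.

Variables (q n m : nat) (S : zseq q).
Hypotheses (q_gt1 : (1 < q)%N) (hS : orientable n m S) (even_m : ~~ odd m).

Let w := alt_weight m S.
Let h := #[w]%g.

Lemma iter_antisum_even j c : iter j (fun d => antisum S d m) c = c + w *+ j.
Proof.
elim: j => [|j IHj]; first by rewrite addr0.
rewrite iterS IHj antisum_alt_weight -signr_odd (negPf even_m) mul1r.
by rewrite -addrA mulrSr.
Qed.

Lemma orientable_antisum_even c : orientable n.+1 (h * m) (antisum S c).
Proof.
have hE j : iter j (fun d => antisum S d m) c = c <-> (h %| j)%N.
  rewrite iter_antisum_even order_Zp_dvd -[X in _ = X <-> _]addr0.
  by split=> [/addrI->|/eqP->].
by apply: (orientable_antisum hS) => [||j _ /hE];
  [exact: order_gt0 | exact/hE |].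
Qed.

End EvenPeriod.

(** * The orbit decomposition in each of the four cases *)

Theorem theorem8 (q n m : nat) (S : zseq q) (hq : (2 <= q)%N) (hn : (1 <= n)%N)
    (hS : orientable n m S) :
  [/\ (* (i) *)
      odd m -> odd q ->
      exists (T : zseq q) (U : 'I_((q - 1) %/ 2) -> zseq q)
             (a : 'I_((q - 1) %/ 2) -> 'I_2 -> nat),
        [/\ orientable n.+1 m T,
            forall k, orientable n.+1 (2 * m) (U k),
            mutual_alt_translates U
          & consists_of (sum_preimage S)
              (join_families (fun _ : unit => T) (shifts_of U a))],
      (* (ii) *)
      odd m -> ~~ odd q -> (exists x : 'Z_q, 2%:R * x = alt_weight m S) ->
      exists (T : 'I_2 -> zseq q) (U : 'I_((q - 2) %/ 2) -> zseq q)
             (a : 'I_((q - 2) %/ 2) -> 'I_2 -> nat),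
        [/\ forall k, orientable n.+1 m (T k),
            mutual_alt_translates T,
            forall k, orientable n.+1 (2 * m) (U k),
            mutual_alt_translates U
          & consists_of (sum_preimage S) (join_families T (shifts_of U a))],
      (* (iii) *)
      odd m -> ~~ odd q -> ~ (exists x : 'Z_q, 2%:R * x = alt_weight m S) ->
      exists (U : 'I_(q %/ 2) -> zseq q) (a : 'I_(q %/ 2) -> 'I_2 -> nat),
        [/\ forall k, orientable n.+1 (2 * m) (U k),
            mutual_alt_translates U
          & consists_of (sum_preimage S) (shifts_of U a)]
    & (* (iv) *)
      ~~ odd m -> forall h : nat, #[alt_weight m S]%g = h ->
      exists (U : 'I_(q %/ h) -> zseq q) (a : 'I_(q %/ h) -> 'I_h -> nat),
        [/\ forall k, orientable n.+1 (h * m) (U k),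
            forall k l, k != l -> o_disjoint n.+1 (U k) (U l),
            mutual_alt_translates U
          & consists_of (sum_preimage S) (shifts_of U a)]].
Proof.
have Eodd p : odd p -> (p = (p %/ 2 * 2).+1)%N.
  by move=> odd_p; rewrite divn2 muln2 -{1}(odd_double_half p) odd_p.
have Eeven p : ~~ odd p -> (p = p %/ 2 * 2)%N.
  by rewrite -dvdn2 => /divnK.
set w := alt_weight m S; split.
- move=> odd_m odd_q; set r := ((q - 1) %/ 2)%N.
  have Eq : q = (r * 2).+1 by rewrite {1}(Eodd q) // /r; lia.
  (* Since [q = 2r + 1], the residue [r + 1] is the inverse of [2], so [c0] is half of [w], the
     fixed point. Offsets [1] to [r] pick one member of each remaining orbit, with [s = q]. *)
  pose c0 : 'Z_q := r.+1%:R * w; pose f (k : 'I_r) := k.+1.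
  have Ew : c0 + c0 + q%:R = w.
    rewrite pchar_Zp // addr0 -mulrDl -natrD addnn -muln2 mulSn addnC addn2.
    by rewrite -Eq -natr1 pchar_Zp // add0r mul1r.
  have f_inj : injective f by move=> k l [] /val_inj.
  have ltf k l : (f k + f l < q)%N.
    by move: (ltn_ord k) (ltn_ord l); rewrite /f; lia.
  have f_gt0 k : (0 < f k < q)%N by have := ltf k k; rewrite /f; lia.
  exists (antisum S c0), (fun k => antisum S (c0 + (f k)%:R)),
    (fun _ j => (j * m)%N).
  split.
  + apply: orientable_antisum_fixed => //.
    (* The fixed point has offset [0], which is matched with [q], the same residue. *)
    rewrite -[X in antisum S X]addr0 (@antisum_odd_swap _ _ _ odd_m c0 0 q) //.
    by rewrite pchar_Zp ?addr0.
  + by move=> k; apply: (orientable_pair hq hS odd_m Ew) => //; rewrite /f; lia.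
  + apply: mutual_alt_translates_antisum => k l /addrI/natr_Zp_inj E.
    by apply/f_inj/E; case/andP: (f_gt0 k) (f_gt0 l) => _ ? /andP[].
  pose N (x : unit + 'I_r * 'I_2) :=
    if x is inr y then pair_offset f q y else 0%N.
  apply: (consists_of_antisum_nat (N := N) (c0 := c0) hq hS).
  + have N0 y := pair_offset_gt0_lt y f_gt0.
    move=> [[]|x] [[]|y] //= E; first by have := N0 y; lia.
      by have := N0 x; lia.
    by rewrite (pair_offset_inj f_inj ltf E).
  + move=> [[]|x] /=; first exact: ltnW.
    by case/andP: (pair_offset_gt0_lt x f_gt0).
  + by rewrite card_sum card_prod card_unit !card_ord add1n -Eq.
  + move=> [[]|x] i /=; first by rewrite addr0.
    apply: (shifts_of_pairs hS odd_m _ Ew) => k.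
    by case/andP: (f_gt0 k) => _ /ltnW.
- move=> odd_m even_q [x0 Ex0]; set r := ((q - 2) %/ 2)%N.
  have Eq : q = (r.+1 * 2)%N by rewrite {1}(Eeven q) // /r; lia.
  (* With the fixed point [x0] as centre and [s = q], the offsets [1] to [r] lie strictly between
     [0] and half of [q]. *)
  pose f (k : 'I_r) := k.+1.
  have Ew : x0 + x0 + q%:R = w by rewrite pchar_Zp // addr0 -mulr2n -mulr_natl.
  have f_inj : injective f by move=> k l [] /val_inj.
  have ltf k l : (f k + f l < q)%N.
    by move: (ltn_ord k) (ltn_ord l); rewrite /f; lia.
  have f_gt0 k : (0 < f k < q)%N by have := ltf k k; rewrite /f; lia.
  (* The offsets [0] and [r + 1], half of [q], have zero double: these are the two fixed points. *)
  pose g (j : 'I_2) : nat := (r.+1 * j)%N.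
  have g_lt j : (g j < q)%N by rewrite [X in (_ < X)%N]Eq /g ltn_pmul2l.
  have g_inj : injective g.
    by move=> i j /eqP; rewrite eqn_pmul2l // => /eqP/val_inj.
  have g_double j : (g j + g j)%:R = 0 :> 'Z_q.
    rewrite addnn -muln2 mulnAC -Eq natrM pchar_Zp ?mul0r //.
  exists (fun j => antisum S (x0 + (g j)%:R)),
    (fun k => antisum S (x0 + (f k)%:R)), (fun _ j => (j * m)%N).
  split.
  + move=> j; apply: orientable_antisum_fixed => //.
    apply: antisum_odd_swap => //.
    by rewrite g_double -(pchar_Zp hq).
  + apply: mutual_alt_translates_antisum => k l /addrI/natr_Zp_inj E.
    exact/g_inj/E.
  + by move=> k; apply: (orientable_pair hq hS odd_m Ew) => //; rewrite /f; lia.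
  + apply: mutual_alt_translates_antisum => k l /addrI/natr_Zp_inj E.
    by apply/f_inj/E; case/andP: (f_gt0 k) (f_gt0 l) => _ ? /andP[].
  pose N (x : 'I_2 + 'I_r * 'I_2) :=
    match x with inl j => g j | inr y => pair_offset f q y end.
  apply: (consists_of_antisum_nat (N := N) (c0 := x0) hq hS).
  + have gN j y : g j <> pair_offset f q y.
      have := ltn_ord y.1; rewrite /pair_offset /g /f.
      by case: j => -[|[|//]] /= _; case: ifP => _; lia.
    move=> [i|x] [j|y] /= E; first by rewrite (g_inj _ _ E).
    * by case: (gN i y).
    * by case: (gN j x).
    by rewrite (pair_offset_inj f_inj ltf E).
  + move=> [j|x] //=.
    by case/andP: (pair_offset_gt0_lt x f_gt0).
  + by rewrite card_sum card_prod !card_ord -mulSn -Eq.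
  + move=> [j|x] i //=.
    apply: (shifts_of_pairs hS odd_m _ Ew) => k.
    by case/andP: (f_gt0 k) => _ /ltnW.
- move=> odd_m even_q no_half; set r := (q %/ 2)%N.
  have Eq : q = (r * 2)%N := Eeven q even_q.
  (* The representative of [w] turns out odd, so [c0 + c0 = w + 1] and the offsets of a pair sum to
     [q - 1]. This sum is odd, so no offset is its own mirror and they can start at [0]. *)
  pose c0 : 'Z_q := (w./2.+1)%:R; pose f (k : 'I_r) : nat := k.
  have odd_w : odd w.
    apply/idPn => even_w; apply: no_half; exists w./2%:R.
    by rewrite -natrM mul2n even_halfK // natr_Zp.
  have Ew : c0 + c0 + (q - 1)%:R = w.
    rewrite -!natrD -[RHS]natr_Zp -[in RHS](odd_double_half w) odd_w.
    suff -> : (w./2.+1 + w./2.+1 + (q - 1) = true + w./2.*2 + q)%N.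
      by rewrite natrD pchar_Zp // addr0.
    by rewrite -addnn; lia.
  have f_inj : injective f by move=> k l /val_inj.
  have ltf k l : (f k + f l < q - 1)%N.
    by move: (ltn_ord k) (ltn_ord l); rewrite /f; lia.
  have lef k : (f k <= q - 1)%N by have := ltf k k; lia.
  exists (fun k => antisum S (c0 + (f k)%:R)), (fun _ j => (j * m)%N).
  split.
  + move=> k; apply: (orientable_pair hq hS odd_m Ew) => //.
    by have := lef k; lia.
  + apply: mutual_alt_translates_antisum => k l /addrI/natr_Zp_inj E.
    by apply/f_inj/E => //; have := (lef k, lef l) => -[]; lia.
  apply: (consists_of_antisum_nat (N := pair_offset f (q - 1)) (c0 := c0) hq
    hS).
  + exact: pair_offset_inj.
  + by move=> x; have := pair_offset_le x lef; lia.
  + by rewrite card_prod !card_ord -Eq.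
  + by move=> x; apply: (shifts_of_pairs hS odd_m _ Ew).
- move=> even_m h <- {h}; set h := #[w]%g.
  pose u (k : 'I_(q %/ h)) : 'Z_q := k%:R.
  have u_inj : injective u.
    move=> k l E; have [] // := @natr_coset_inj q w hq k l 0 0.
    by rewrite !addr0.
  exists (fun k => antisum S (u k)), (fun _ j => (j * m)%N); split.
  + by move=> k; exact: orientable_antisum_even.
  + move=> k l nkl; apply: (o_disjoint_antisum hS) => j.
    (* The added [w *+ 0] gives both sides the form of a coset representative plus a multiple of
       [w]. *)
    * rewrite iter_antisum_even // -[RHS]addr0 -[X in _ = _ + X](mulr0n w).
      by case/(natr_coset_inj hq) => /eqP; rewrite (negPf nkl).
    * rewrite iter_antisum_even // -[RHS]addr0 -[X in _ = _ + X](mulr0n w).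
      by case/(natr_coset_inj hq) => /eqP; rewrite eq_sym (negPf nkl).
  + exact: mutual_alt_translates_antisum.
  (* The initial term of the shift by [x.2 * m]: a coset representative moved along its coset of
     [<w>]. *)
  pose e (x : 'I_(q %/ h) * 'I_h) : 'Z_q := u x.1 + w *+ x.2.
  apply: (consists_of_antisum hS hq (e := e)).
  + move=> [k i] [l j] /(natr_coset_inj hq)[/= -> /mulrn_order_inj E].
    by rewrite E.
  + by rewrite card_prod !card_ord divnK // order_Zp_dvd_modulus.
  + by move=> x i; rewrite /shifts_of (shift_antisum hS) iter_antisum_even.
Qed.
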